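(* Let $G_1\,{}_\alpha\diamond_\beta\,G_2$ be the doubly warped product of two weighted graphs with warping functions $\alpha:G_2\to(0,\infty)$, $\beta:G_1\to(0,\infty)$, let $x\in G_1$, $p\in G_2$, and let $\mathcal N_1,\mathcal N_2>0$ be real. Set $$\mathcal Q_1(c_1,c_2)=\tfrac12c_1^2\beta^{-2}\Delta^{G_2}\alpha^{-2}+|c_1c_2|\big(\beta^{-2}\mathrm D_x+\tfrac12\alpha^{-2}\Gamma^{G_1}(\beta^{-2})\big),$$ $$\mathcal Q_2(c_1,c_2)=\tfrac12c_2^2\alpha^{-2}\Delta^{G_1}\beta^{-2}+|c_1c_2|\big(\alpha^{-2}\mathrm D_p+\tfrac12\beta^{-2}\Gamma^{G_2}(\alpha^{-2})\big).$$ Then $$\mathcal K_{(x,p)}(\mathcal N_1+\mathcal N_2)\le\max\big\{\alpha^{-2}\mathcal K_{G_1,x}(\mathcal N_1)+\alpha^2\mathcal Q_1(1,1)+2\mathcal N_1^{-1}\mathcal N_2(\mathcal N_1+\mathcal N_2)^{-1}\mathrm D_x,\ \beta^{-2}\mathcal K_{G_2,p}(\mathcal N_2)+\beta^2\mathcal Q_2(1,1)+2\mathcal N_1\mathcal N_2^{-1}(\mathcal N_1+\mathcal N_2)^{-1}\mathrm D_p\big\}.$$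
   Context: A weighted graph $(G,\omega,m)$ consists of a countable vertex set $G$, nonnegative edge weights $\omega_{xy}$, not necessarily symmetric but with $\omega_{xy}=s(x,y)\omega_{yx}$ for some $s(x,y)\neq0$, and a vertex measure $m:G\to(0,\infty)$. Write $x\sim y$ if $\omega_{xy}>0$; every vertex has at least one neighbour and only finitely many. $\mathrm D_x=\mathrm{Deg}_G(x)=m(x)^{-1}\sum_{y\sim x}\omega_{xy}$. For $f:G\to\mathbb R$, $\Delta f(x)=m(x)^{-1}\sum_{y\sim x}(f(y)-f(x))\omega_{xy}$; $\Gamma(u,v)=\frac12(\Delta(uv)-v\Delta u-u\Delta v)$, $\Gamma_2(u,v)=\frac12(\Delta\Gamma(u,v)-\Gamma(\Delta u,v)-\Gamma(u,\Delta v))$, $\Gamma(f)=\Gamma(f,f)$, $\Gamma_2(f)=\Gamma_2(f,f)$. A superscript $G_i$ indicates the graph in which the operator is taken. For $\mathcal N\in(0,\infty]$ ($\infty^{-1}=0$), $\mathcal K_{G,x}(\mathcal N)$ is the largest $\mathcal K$ with $\Gamma_2(f)(x)\ge\mathcal N^{-1}(\Delta f(x))^2+\mathcal K\,\Gamma(f)(x)$ for all $f:G\to\mathbb R$. The doubly warped product $G_1\,{}_\alpha\diamond_\beta\,G_2$ of $(G_1,\omega^{G_1},m^{G_1})$ and $(G_2,\omega^{G_2},m^{G_2})$ is the Cartesian product graph on $G_1\times G_2$ with vertex measure $m((x,p))=m^{G_1}(x)m^{G_2}(p)$ and edge weights $\omega_{((x,p),(y,q))}=\delta_{pq}\,m^{G_2}(p)\,\alpha^{-2}(p)\,\omega^{G_1}_{xy}+\delta_{xy}\,m^{G_1}(x)\,\beta^{-2}(x)\,\omega^{G_2}_{pq}$.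 $\mathcal K_{(x,p)}$ is its curvature function at $(x,p)$. In all formulas $\alpha=\alpha(p)$, $\beta=\beta(x)$, $\Delta^{G_2}\alpha^{-2}$ and $\Gamma^{G_2}(\alpha^{-2})$ are evaluated at $p$, $\Delta^{G_1}\beta^{-2}$ and $\Gamma^{G_1}(\beta^{-2})$ at $x$, and $\mathrm D_x=\mathrm{Deg}_{G_1}(x)$, $\mathrm D_p=\mathrm{Deg}_{G_2}(p)$. *)

(* Defs.v *)
From HB Require Import structures.
From mathcomp Require Import all_boot all_order all_algebra.
From mathcomp Require Import all_classical all_reals ereal.
From mathcomp Require Import ring lra.

Set Implicit Arguments.
Unset Strict Implicit.
Unset Printing Implicit Defensive.

Import Order.TTheory GRing.Theory Num.Theory.

Local Open Scope classical_set_scope.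
Local Open Scope ring_scope.

(* Weights need not be symmetric: [wg_sym] only forces their supports to be.
   Loops are not excluded. *)
Record wgraph (R : realType) := WGraph {
  vertex :> countType;
  weight : vertex -> vertex -> R;
  vmeas : vertex -> R;
  weight_ge0 : forall x y, 0 <= weight x y;
  weight_sym : exists s : vertex -> vertex -> R,
    forall x y, s x y != 0 /\ weight x y = s x y * weight y x;
  vmeas_gt0 : forall x, 0 < vmeas x;
  nbr_ex : forall x, exists y, 0 < weight x y;
  nbr_fin : forall x, finite_set [set y | 0 < weight x y] }.

Arguments weight {R} G x y : rename.
Arguments vmeas {R} G x : rename.

Section Operators.
Context {R : realType} (G : wgraph R).
Implicit Types (f u v : G -> R) (x y : G).

Definition nbrs x : set G := [set y | 0 < weight G x y].

Definition deg x : R := (vmeas G x)^-1 * \sum_(y \in nbrs x) weight G x y.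

Definition laplace f x : R :=
  (vmeas G x)^-1 * \sum_(y \in nbrs x) (f y - f x) * weight G x y.

Definition gamma u v x : R :=
  2^-1 * (laplace (fun y => u y * v y) x - v x * laplace u x
          - u x * laplace v x).

Definition gamma2 u v x : R :=
  2^-1 * (laplace (gamma u v) x - gamma (laplace u) v x
          - gamma u (laplace v) x).

(* For [N = +oo] the extended inverse is [0]; it is only meant for [0 < N]. *)
Definition CD x (N : \bar R) (K : R) : Prop :=
  forall f, fine (N^-1)%E * laplace f x ^+ 2 + K * gamma f f x
            <= gamma2 f f x.

(* The largest [K] such that [CD x N K], see [curvature_largest]. It is an
   extended real because a vertex whose only neighbour is itself satisfies
   [CD x N K] for every [K]; its curvature is [+oo]. *)
Definition curvature x (N : \bar R) : \bar R :=
  ereal_sup [set K%:E | K in [set K | CD x N K]].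

Lemma curvature_largest x N K : curvature x N = K%:E ->
  CD x N K /\ forall K', CD x N K' -> K' <= K.
Proof.
move=> cE; have ub K' : CD x N K' -> K' <= K.
  by move=> h; rewrite -lee_fin -cE; apply: ereal_sup_ubound; exists K'.
split=> // f; rewrite leNgt; apply/negP => hlt.
set a := fine _ * _ in hlt; set g := gamma f f x in hlt.
set d := a + K * g - gamma2 f f x.
have d_gt0 : 0 < d by rewrite subr_gt0.
have g1_gt0 : 0 < `|g| + 1 by rewrite ltr_wpDl.
pose e := d / (`|g| + 1).
have e_gt0 : 0 < e by rewrite divr_gt0.
have /ereal_sup_gt[_ [K' hK' <-]] : ((K - e)%:E < curvature x N)%E.
  by rewrite cE lte_fin ltrBlDr ltrDl.
rewrite lte_fin => ltK'; have leK' := ub _ hK'; have := hK' f.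
rewrite -/a -/g leNgt => /negP; apply.
have : (K - K') * g < d.
  apply: (@le_lt_trans _ _ ((K - K') * `|g|)).
    by rewrite ler_wpM2l ?subr_ge0 // ler_norm.
  apply: (@le_lt_trans _ _ (e * `|g|)).
    by rewrite ler_wpM2r // lerBlDr -lerBlDl ltW.
  have -> : d = e * (`|g| + 1) by rewrite mulfVK ?gt_eqF.
  by rewrite ltr_pM2l // ltrDl.
rewrite /d; lra.
Qed.

End Operators.

Section WarpedProduct.
Context {R : realType} {G1 G2 : wgraph R}.
Variables (alpha : G2 -> R) (beta : G1 -> R).

Definition dw_weight (z w : G1 * G2) : R :=
  (z.2 == w.2)%:R * vmeas G2 z.2 * alpha z.2 ^- 2 * weight G1 z.1 w.1
  + (z.1 == w.1)%:R * vmeas G1 z.1 * beta z.1 ^- 2 * weight G2 z.2 w.2.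

Definition dw_meas (z : G1 * G2) : R := vmeas G1 z.1 * vmeas G2 z.2.

Hypotheses (alpha_gt0 : forall p, 0 < alpha p)
  (beta_gt0 : forall x, 0 < beta x).

Let left_ge0 (z w : G1 * G2) :
  0 <= (z.2 == w.2)%:R * vmeas G2 z.2 * alpha z.2 ^- 2 * weight G1 z.1 w.1.
Proof.
rewrite !mulr_ge0 ?ler0n ?weight_ge0 ?invr_ge0 ?exprn_ge0 ?ltW //.
exact: vmeas_gt0.
Qed.

Let right_ge0 (z w : G1 * G2) :
  0 <= (z.1 == w.1)%:R * vmeas G1 z.1 * beta z.1 ^- 2 * weight G2 z.2 w.2.
Proof.
rewrite !mulr_ge0 ?ler0n ?weight_ge0 ?invr_ge0 ?exprn_ge0 ?ltW //.
exact: vmeas_gt0.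
Qed.

Lemma dw_weight_ge0 z w : 0 <= dw_weight z w.
Proof. exact: addr_ge0. Qed.

Lemma weight_symE (G : wgraph R) (x y : G) :
  (0 < weight G x y) = (0 < weight G y x).
Proof.
have [s hs] := weight_sym G.
rewrite !lt0r !weight_ge0 !andbT; have [sn0 ->] := hs x y.
by rewrite mulf_eq0 (negPf sn0).
Qed.

Lemma dw_weight_gt0 (z w : G1 * G2) : (0 < dw_weight z w) =
  (z.2 == w.2) && (0 < weight G1 z.1 w.1)
  || (z.1 == w.1) && (0 < weight G2 z.2 w.2).
Proof.
rewrite lt0r dw_weight_ge0 andbT /dw_weight paddr_eq0 // negb_and.
rewrite !mulf_eq0 !pnatr_eq0 !eqb0 !invr_eq0 !expf_eq0 /=.
rewrite !(gt_eqF (vmeas_gt0 _)) !(gt_eqF (alpha_gt0 _)) !(gt_eqF (beta_gt0 _)).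
by rewrite !orbF !negb_or !negbK !lt0r !weight_ge0 !andbT.
Qed.

Lemma dw_weight_sym : exists s : G1 * G2 -> G1 * G2 -> R,
  forall z w, s z w != 0 /\ dw_weight z w = s z w * dw_weight w z.
Proof.
exists (fun z w => if 0 < dw_weight z w then dw_weight z w / dw_weight w z
                   else 1) => z w.
have symE : (0 < dw_weight z w) = (0 < dw_weight w z).
  by rewrite !dw_weight_gt0 [z.2 == _]eq_sym [z.1 == _]eq_sym
     weight_symE [0 < weight G2 _ _]weight_symE.
case: ifPn => [zw|]; last first.
  rewrite [X in ~~ X -> _]lt0r dw_weight_ge0 andbT negbK => /eqP zw.
  split; first exact: oner_neq0.
  rewrite zw mul1r; apply/esym/eqP; move: symE.
  by rewrite zw ltxx lt0r dw_weight_ge0 andbT => /esym/negbFE.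
have wz : dw_weight w z != 0 by rewrite gt_eqF -?symE.
by split; [rewrite mulf_neq0 ?invr_eq0 ?gt_eqF // lt0r wz dw_weight_ge0
          | rewrite mulfVK].
Qed.

Lemma dw_meas_gt0 z : 0 < dw_meas z.
Proof. by rewrite mulr_gt0 ?vmeas_gt0. Qed.

Lemma dw_nbr_ex z : exists w, 0 < dw_weight z w.
Proof.
have [y hy] := nbr_ex z.1; exists (y, z.2).
by rewrite dw_weight_gt0 /= eqxx hy.
Qed.

Lemma dw_nbr_fin z : finite_set [set w | 0 < dw_weight z w].
Proof.
apply: (@sub_finite_set _ _
  ([set y | 0 < weight G1 z.1 y] `*` [set z.2]
   `|` [set z.1] `*` [set q | 0 < weight G2 z.2 q])).
  move=> [y q] /=; rewrite dw_weight_gt0 /=.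
  by case/orP => /andP[/eqP e h]; [left|right].
by rewrite finite_setU; split; apply: finite_setX; rewrite ?nbr_fin //;
  [exact: nbr_fin|exact: nbr_fin].
Qed.

Definition dw_prod : wgraph R :=
  @WGraph R (G1 * G2)%type dw_weight dw_meas dw_weight_ge0 dw_weight_sym
    dw_meas_gt0 dw_nbr_ex dw_nbr_fin.

Definition Q1 (x : G1) (p : G2) (c1 c2 : R) : R :=
  2^-1 * c1 ^+ 2 * beta x ^- 2 * laplace (fun q => alpha q ^- 2) p
  + `|c1 * c2| * (beta x ^- 2 * deg x
      + 2^-1 * alpha p ^- 2
        * gamma (fun y => beta y ^- 2) (fun y => beta y ^- 2) x).

Definition Q2 (x : G1) (p : G2) (c1 c2 : R) : R :=
  2^-1 * c2 ^+ 2 * alpha p ^- 2 * laplace (fun y => beta y ^- 2) x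
  + `|c1 * c2| * (alpha p ^- 2 * deg p
      + 2^-1 * beta x ^- 2
        * gamma (fun q => alpha q ^- 2) (fun q => alpha q ^- 2) p).

End WarpedProduct.

Arguments dw_prod {R G1 G2 alpha beta} alpha_gt0 beta_gt0.

(* Main.v *)
(* For a separable function F(y, q) = g1 y + g2 q the operator Gamma_2 of the
   product splits into Gamma_2 of the factors, the terms with Delta alpha^-2 and
   Delta beta^-2, and a cross term that Q1 and Q2 absorb. If K exceeded the
   maximum, there would be f1 and f2 violating the curvature-dimension
   inequalities of the two factors; F = c1 f1 + c2 f2, with c1 and c2 balancing
   the two Laplacians in the ratio N1 : N2, then violates that of the product.
   The degree terms of the bound are nonnegative and only weaken it. *)
Require Import Defs.
From HB Require Import structures.
From mathcomp Require Import all_boot all_order all_algebra.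
From mathcomp Require Import all_classical all_reals ereal.
From mathcomp Require Import ring lra.

Set Implicit Arguments.
Unset Strict Implicit.
Unset Printing Implicit Defensive.

Import Order.TTheory GRing.Theory Num.Theory.

Local Open Scope ring_scope.

(** * Weighted neighbour sums and the calculus of [laplace] and [gamma] *)

Section Average.
Context {R : realType} (G : wgraph R).
Implicit Types (f g u v h : G -> R) (x y : G) (c : R).

(** Not normalised: the constant 1 has value [deg x]. As [deg], [laplace] and [gamma] are all of
    this form, linearity and positivity of [avg] reduce facts about them to pointwise algebra. *)
Definition avg h x : R :=
  (vmeas G x)^-1 * \sum_(y \in nbrs x) h y * weight G x y.

Lemma avgD f g x : avg (fun y => f y + g y) x = avg f x + avg g x.
Proof.
rewrite /avg -mulrDr -fsbig_split; last exact: nbr_fin.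
by congr (_ * _); apply: eq_fsbigr => y _; exact: mulrDl.
Qed.

Lemma avgZ c f x : avg (fun y => c * f y) x = c * avg f x.
Proof.
rewrite /avg [RHS]mulrCA; congr (_ * _); rewrite mulr_fsumr.
by apply: eq_fsbigr => y _; exact/esym/mulrA.
Qed.

Lemma avg_ge0 f x : (forall y, 0 <= f y) -> 0 <= avg f x.
Proof.
move=> f0; rewrite mulr_ge0 //; first by rewrite invr_ge0 ltW ?vmeas_gt0.
by apply: fsumr_ge0 => y _; rewrite mulr_ge0 ?weight_ge0.
Qed.

(** The average of [(s * u y + t * v y) ^+ 2] is a nonnegative quadratic form in [s] and [t];
    suitable values of [s] and [t] bound its discriminant. *)
Lemma avg_CauchySchwarz u v x :
  avg (fun y => u y * v y) x ^+ 2
  <= avg (fun y => u y ^+ 2) x * avg (fun y => v y ^+ 2) x.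
Proof.
set a := avg (fun y => u y ^+ 2) x; set c := avg (fun y => v y ^+ 2) x.
set b := avg _ x.
have a0 : 0 <= a by apply: avg_ge0 => y; exact: sqr_ge0.
have c0 : 0 <= c by apply: avg_ge0 => y; exact: sqr_ge0.
have quad s t : 0 <= s ^+ 2 * a + 2 * s * t * b + t ^+ 2 * c.
  rewrite /a /b /c -!avgZ -!avgD; apply: avg_ge0 => y.
  suff -> : s ^+ 2 * u y ^+ 2 + 2 * s * t * (u y * v y) + t ^+ 2 * v y ^+ 2
    = (s * u y + t * v y) ^+ 2 by exact: sqr_ge0.
  by ring.
rewrite -subr_ge0; case: (ltrgt0P a) a0 => // [a0|a0] _.
  (* At this point the form equals [a] times the wanted difference, so [a > 0] can be cancelled; the
     case [c > 0] below is symmetric. *)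
  have := quad (- b) a.
  have -> : (- b) ^+ 2 * a + 2 * - b * a * b + a ^+ 2 * c
    = a * (a * c - b ^+ 2) by ring.
  by rewrite pmulr_rge0.
case: (ltrgt0P c) c0 => // [c0|c0] _.
  have := quad c (- b).
  have -> : c ^+ 2 * a + 2 * c * - b * b + (- b) ^+ 2 * c
    = c * (a * c - b ^+ 2) by ring.
  by rewrite pmulr_rge0.
(* With [a = c = 0] only the mixed term is left, here [- 2 * b ^+ 2], which forces [b = 0]. *)
have := quad 1 (- b); rewrite a0 c0; nra.
Qed.

Lemma degE x : deg x = avg (fun=> 1) x.
Proof. by congr (_ * _); apply: eq_fsbigr => y _; rewrite mul1r. Qed.

Lemma laplaceE f x : laplace f x = avg (fun y => f y - f x) x.
Proof. by []. Qed.

Lemma gammaE u v x :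
  gamma u v x = 2^-1 * avg (fun y => (u y - u x) * (v y - v x)) x.
Proof.
have -> : (fun y => (u y - u x) * (v y - v x)) = fun y =>
    u y * v y - u x * v x + - v x * (u y - u x) + - u x * (v y - v x).
  by apply/funext => y; ring.
by rewrite !avgD !avgZ /gamma !laplaceE avgD; ring.
Qed.

Lemma laplaceD f g x :
  laplace (fun y => f y + g y) x = laplace f x + laplace g x.
Proof.
by rewrite !laplaceE -avgD; congr (avg _ x); apply/funext => y; ring.
Qed.

Lemma laplaceZ c f x : laplace (fun y => c * f y) x = c * laplace f x.
Proof.
by rewrite !laplaceE -avgZ; congr (avg _ x); apply/funext => y; ring.
Qed.

Lemma laplace_cst c x : laplace (fun=> c) x = 0.
Proof.
rewrite laplaceE; have -> : (fun _ : G => c - c) = fun=> 0 * c.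
  by apply/funext => y; ring.
by rewrite avgZ mul0r.
Qed.

Lemma gammaC u v x : gamma u v x = gamma v u x.
Proof.
by rewrite !gammaE; congr (_ * avg _ x); apply/funext => y; rewrite mulrC.
Qed.

Lemma gammaDl u v g x :
  gamma (fun y => u y + v y) g x = gamma u g x + gamma v g x.
Proof.
rewrite !gammaE -mulrDr -avgD; congr (_ * avg _ x).
by apply/funext => y; ring.
Qed.

Lemma gammaZl c u v x : gamma (fun y => c * u y) v x = c * gamma u v x.
Proof.
rewrite !gammaE [RHS]mulrCA -(avgZ c); congr (_ * avg _ x).
by apply/funext => y; ring.
Qed.

Lemma laplace_lin (a b : R) f g x :
  laplace (fun y => a * f y + b * g y) x = a * laplace f x + b * laplace g x.
Proof. by rewrite laplaceD !laplaceZ. Qed.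

Lemma gamma_linr (a b : R) u f g x :
  gamma u (fun y => a * f y + b * g y) x = a * gamma u f x + b * gamma u g x.
Proof. by rewrite gammaC gammaDl !gammaZl !(gammaC u). Qed.

Lemma gammaZr c u v x : gamma u (fun y => c * v y) x = c * gamma u v x.
Proof. by rewrite gammaC gammaZl gammaC. Qed.

Lemma gamma_cstl c u x : gamma (fun=> c) u x = 0.
Proof.
rewrite gammaE; have -> : (fun y => (c - c) * (u y - u x)) = fun y => 0 * u y.
  by apply/funext => y; ring.
by rewrite avgZ mul0r mulr0.
Qed.

Lemma gamma_ge0 u x : 0 <= gamma u u x.
Proof.
rewrite gammaE mulr_ge0 ?invr_ge0 //.
by apply: avg_ge0 => y; rewrite -expr2 sqr_ge0.
Qed.

Lemma deg_ge0 x : 0 <= deg x.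
Proof. by rewrite degE; apply: avg_ge0. Qed.

Lemma gamma_CauchySchwarz u v x :
  gamma u v x ^+ 2 <= gamma u u x * gamma v v x.
Proof.
rewrite !gammaE exprMn [leRHS]mulrACA -(expr2 2^-1).
rewrite ler_pM2l ?exprn_gt0 ?invr_gt0 //.
exact: (avg_CauchySchwarz (fun y => u y - u x) (fun y => v y - v x)).
Qed.

(** Cauchy-Schwarz for the increments of [f] against the constant 1; the factor 2 undoes the one
    half in [gamma]. *)
Lemma sqr_laplace_le f x : laplace f x ^+ 2 <= 2 * deg x * gamma f f x.
Proof.
rewrite laplaceE gammaE degE mulrACA mulfV // mul1r.
have := avg_CauchySchwarz (fun=> 1) (fun y => f y - f x) x.
under eq_fun do rewrite mul1r.
by under [X in _ <= avg X _ * _ -> _]eq_fun do rewrite expr1n.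
Qed.

Lemma gamma2Z c f x :
  gamma2 (fun y => c * f y) (fun y => c * f y) x = c ^+ 2 * gamma2 f f x.
Proof.
have gE : gamma (fun y => c * f y) (fun y => c * f y)
    = fun y => c ^+ 2 * gamma f f y.
  by apply/funext => y; rewrite gammaZl gammaZr mulrA.
have lE : laplace (fun y => c * f y) = fun y => c * laplace f y.
  by apply/funext => y; rewrite laplaceZ.
by rewrite /gamma2 gE lE laplaceZ !(gammaZl, gammaZr); ring.
Qed.

End Average.

(** * The operators on the warped product and its [gamma2] on separable functions *)

Section Product.
Context {R : realType} {G1 G2 : wgraph R}.
Variables (alpha : G2 -> R) (beta : G1 -> R).
Hypotheses (alpha_gt0 : forall p, 0 < alpha p)
  (beta_gt0 : forall x, 0 < beta x).

Local Notation P := (dw_prod alpha_gt0 beta_gt0).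
Local Notation A := (fun q => alpha q ^- 2).
Local Notation B := (fun y => beta y ^- 2).

(** The weight is split into its two summands rather than the neighbours into two classes: with
    loops, [(x, p)] itself may be a neighbour through both factors. *)
Lemma avg_dw_prod (h : P -> R) (x : G1) (p : G2) :
  avg h (x, p) = A p * avg (fun y => h (y, p)) x
                 + B x * avg (fun q => h (x, q)) p.
Proof.
have m1 := vmeas_gt0 x; have m2 := vmeas_gt0 p.
pose t1 (w : P) := h w * ((p == w.2)%:R * vmeas G2 p * A p * weight G1 x w.1).
pose t2 (w : P) := h w * ((x == w.1)%:R * vmeas G1 x * B x * weight G2 p w.2).
have E1 : \sum_(w \in nbrs ((x, p) : P)) t1 w
    = vmeas G2 p * A p * \sum_(y \in nbrs x) h (y, p) * weight G1 x y.
  (* [t1] vanishes at every product neighbour outside the horizontal copy of [nbrs x]. *)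
  rewrite -(@fsbig_widen _ _ _ _ ((fun y => (y, p) : P) @` nbrs x)).
  - rewrite fsbig_image; last by move=> y y' _ _ [].
    rewrite mulr_fsumr; apply: eq_fsbigr => y _.
    by rewrite /t1 /= eqxx -[true%:R]/(1 : R); ring.
  - by move=> _ [y xy <-]; rewrite /nbrs/= dw_weight_gt0 //= eqxx xy.
  - move=> -[y q] [] _ /= nyq; rewrite /t1 /=.
    case: eqP => [pq|]; last by rewrite !mul0r mulr0.
    have [xy|] := boolP (0 < weight G1 x y).
      by case: nyq; exists y; rewrite ?pq.
    rewrite lt0r weight_ge0 andbT negbK => /eqP ->; ring.
have E2 : \sum_(w \in nbrs ((x, p) : P)) t2 w
    = vmeas G1 x * B x * \sum_(q \in nbrs p) h (x, q) * weight G2 p q.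
  rewrite -(@fsbig_widen _ _ _ _ ((fun q => (x, q) : P) @` nbrs p)).
  - rewrite fsbig_image; last by move=> y y' _ _ [].
    rewrite mulr_fsumr; apply: eq_fsbigr => q _.
    by rewrite /t2 /= eqxx -[true%:R]/(1 : R); ring.
  - by move=> _ [q pq <-]; rewrite /nbrs/= dw_weight_gt0 //= eqxx pq orbT.
  - move=> -[y q] [] _ /= nyq; rewrite /t2 /=.
    case: eqP => [xy|]; last by rewrite !mul0r mulr0.
    have [pq|] := boolP (0 < weight G2 p q).
      by case: nyq; exists q; rewrite ?xy.
    rewrite lt0r weight_ge0 andbT negbK => /eqP ->; ring.
rewrite /avg.
have -> : \sum_(w \in nbrs ((x, p) : P)) h w * weight P (x, p) w
    = \sum_(w \in nbrs ((x, p) : P)) t1 w + \sum_(w \in nbrs ((x, p) : P)) t2 w.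
  rewrite -fsbig_split; last exact: nbr_fin.
  by apply: eq_fsbigr => w _; exact: mulrDr.
rewrite E1 E2 /= /dw_meas /=.
by field; rewrite !gt_eqF.
Qed.

Lemma laplace_dw_prod (h : P -> R) (x : G1) (p : G2) :
  laplace h (x, p) = A p * laplace (fun y => h (y, p)) x
                     + B x * laplace (fun q => h (x, q)) p.
Proof. by rewrite laplaceE avg_dw_prod -!laplaceE. Qed.

Lemma gamma_dw_prod (u v : P -> R) (x : G1) (p : G2) :
  gamma u v (x, p)
  = A p * gamma (fun y => u (y, p)) (fun y => v (y, p)) x
    + B x * gamma (fun q => u (x, q)) (fun q => v (x, q)) p.
Proof. by rewrite gammaE avg_dw_prod !gammaE; ring. Qed.

Variables (f1 : G1 -> R) (f2 : G2 -> R).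
Let F : P -> R := fun z => f1 z.1 + f2 z.2.

Lemma laplace_sum (x : G1) (p : G2) :
  laplace F (x, p) = A p * laplace f1 x + B x * laplace f2 p.
Proof.
rewrite laplace_dw_prod.
rewrite (laplaceD f1 (fun=> f2 p)) (laplaceD (fun=> f1 x) f2).
by rewrite !laplace_cst addr0 add0r.
Qed.

Let gamma_suml (v : P -> R) (x : G1) (p : G2) :
  gamma F v (x, p) = A p * gamma f1 (fun y => v (y, p)) x
                     + B x * gamma f2 (fun q => v (x, q)) p.
Proof.
rewrite gamma_dw_prod.
rewrite (gammaDl f1 (fun=> f2 p)) (gammaDl (fun=> f1 x) f2).
by rewrite !gamma_cstl addr0 add0r.
Qed.

Lemma gamma_sum (x : G1) (p : G2) :
  gamma F F (x, p) = A p * gamma f1 f1 x + B x * gamma f2 f2 p.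
Proof.
rewrite gamma_suml (gammaC f1) (gammaC f2).
rewrite (gammaDl f1 (fun=> f2 p)) (gammaDl (fun=> f1 x) f2).
by rewrite !gamma_cstl addr0 add0r.
Qed.

(** In [gamma F F] and [laplace F] each factor's part carries a coefficient depending on the other
    coordinate. Applying [laplace] to the first yields the terms with [laplace A] and [laplace B];
    pairing [F] with the second yields the two subtracted cross terms. *)
Lemma gamma2_sum (x : G1) (p : G2) :
  gamma2 F F (x, p)
  = A p ^+ 2 * gamma2 f1 f1 x + B x ^+ 2 * gamma2 f2 f2 p
    + 2^-1 * B x * laplace A p * gamma f1 f1 x
    + 2^-1 * A p * laplace B x * gamma f2 f2 p
    - (A p * laplace f2 p * gamma f1 B x + B x * laplace f1 x * gamma f2 A p).
Proof.
have gE : gamma F F = (fun z : P =>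
    A z.2 * gamma f1 f1 z.1 + B z.1 * gamma f2 f2 z.2).
  by apply/funext => -[y q]; rewrite gamma_sum.
have lE : laplace F = (fun z : P =>
    A z.2 * laplace f1 z.1 + B z.1 * laplace f2 z.2).
  by apply/funext => -[y q]; rewrite laplace_sum.
(* Freezing one coordinate leaves some constant factors on the right; [ev] and [ev'] restore the
   shape that [laplace_lin] and [gamma_linr] match. *)
have ev (G : wgraph R) (a b : R) (u v : G -> R) :
    (fun y => a * u y + v y * b) = (fun y => a * u y + b * v y).
  by apply/funext => y; rewrite (mulrC b).
have ev' (G : wgraph R) (a b : R) (u v : G -> R) :
    (fun y => u y * a + b * v y) = (fun y => a * u y + b * v y).
  by apply/funext => y; rewrite (mulrC a).
rewrite /gamma2 (gammaC (laplace F)) gamma_suml gE lE laplace_dw_prod /=.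
rewrite !ev !ev'.
rewrite !laplace_lin !gamma_linr !(gammaC f1) !(gammaC f2).
by field; rewrite ?gt_eqF.
Qed.

(* Young's inequality on the two cross terms, combined with
   [(laplace f) ^ 2 <= 2 * deg * gamma f] and Cauchy-Schwarz for [gamma]. *)
Lemma gamma2_sum_le (x : G1) (p : G2) :
  gamma2 F F (x, p)
  <= A p ^+ 2 * gamma2 f1 f1 x + B x ^+ 2 * gamma2 f2 f2 p
     + Q1 alpha beta x p 1 1 * gamma f1 f1 x
     + Q2 alpha beta x p 1 1 * gamma f2 f2 p.
Proof.
rewrite gamma2_sum /Q1 /Q2 mulr1 normr1 expr1n.
have A0 : 0 < A p by rewrite invr_gt0 exprn_gt0.
have B0 : 0 < B x by rewrite invr_gt0 exprn_gt0.
have young (t a b X Y : R) : 0 < t -> a ^+ 2 <= 2 * X -> b ^+ 2 <= 2 * Y ->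
    - (t * (a * b)) <= t * (X + Y).
  move=> t0 aX bY; rewrite -mulrN ler_pM2l //.
  have := sqr_ge0 (a + b); rewrite sqrrD; lra.
have c1 : - (A p * (laplace f2 p * gamma f1 B x))
    <= A p * (deg p * gamma f2 f2 p + 2^-1 * (gamma f1 f1 x * gamma B B x)).
  apply: young => //; first by rewrite mulrA sqr_laplace_le.
  by rewrite mulrA divff // mul1r gamma_CauchySchwarz.
have c2 : - (B x * (laplace f1 x * gamma f2 A p))
    <= B x * (deg x * gamma f1 f1 x + 2^-1 * (gamma f2 f2 p * gamma A A p)).
  apply: young => //; first by rewrite mulrA sqr_laplace_le.
  by rewrite mulrA divff // mul1r gamma_CauchySchwarz.
rewrite -subr_ge0.
set lhs := (X in 0 <= X).
(* The gap between the two sides is exactly the slack of [c1] plus that of [c2]. *)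
suff -> : lhs
   = A p * (deg p * gamma f2 f2 p + 2^-1 * (gamma f1 f1 x * gamma B B x))
     + A p * (laplace f2 p * gamma f1 B x)
   + (B x * (deg x * gamma f1 f1 x + 2^-1 * (gamma f2 f2 p * gamma A A p))
     + B x * (laplace f1 x * gamma f2 A p)).
  by rewrite addr_ge0 // -[X in _ + X]opprK subr_ge0.
by rewrite /lhs; ring.
Qed.

End Product.

(** * From curvature bounds to violating functions, and the final estimate *)

Lemma CD_fin (R : realType) (G : wgraph R) (x : G) (N K : R) : N != 0 ->
  CD x N%:E K <->
  forall f, N^-1 * laplace f x ^+ 2 + K * gamma f f x <= gamma2 f f x.
Proof. by move=> N0; rewrite /CD inver (negPf N0). Qed.

(** An admissible constant lies below the supremum, and [a^-1 * (K - c)] is the one that the affine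
    map sends to [K]. Working in the extended reals covers infinite curvature without a case
    split. *)
Lemma curvature_lt_notCD (R : realType) (G : wgraph R) (x : G) (N K a c : R) :
  0 < a -> (a%:E * curvature x N%:E + c%:E < K%:E)%E ->
  ~ CD x N%:E (a^-1 * (K - c)).
Proof.
move=> a0 + cd; apply/negP; rewrite -leNgt.
have : ((a^-1 * (K - c))%:E <= curvature x N%:E)%E.
  by apply: ereal_sup_ubound; exists (a^-1 * (K - c)).
move=> /(lee_wpmul2l (_ : (0 <= a%:E)%E)) h.
apply: le_trans (leeD2r _ (h _)); last by rewrite lee_fin ltW.
by rewrite -EFinM -EFinD lee_fin mulrA mulfV ?gt_eqF // mul1r subrK.
Qed.

Theorem corollary1p16 (R : realType) (G1 G2 : wgraph R)
    (alpha : G2 -> R) (beta : G1 -> R)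
    (alpha_gt0 : forall q, 0 < alpha q) (beta_gt0 : forall y, 0 < beta y)
    (x : G1) (p : G2) (N1 N2 : R) (N1_gt0 : 0 < N1) (N2_gt0 : 0 < N2) :
  (@curvature R (dw_prod alpha_gt0 beta_gt0) (x, p) (N1 + N2)%:E
   <= maxe
     ((alpha p ^- 2)%:E * @curvature R G1 x N1%:E
      + (alpha p ^+ 2 * Q1 alpha beta x p 1 1)%:E
      + (2 * N1^-1 * N2 * (N1 + N2)^-1 * deg x)%:E)
     ((beta x ^- 2)%:E * @curvature R G2 p N2%:E
      + (beta x ^+ 2 * Q2 alpha beta x p 1 1)%:E
      + (2 * N1 * N2^-1 * (N1 + N2)^-1 * deg p)%:E))%E.
Proof.
pose A := alpha p ^- 2; pose B := beta x ^- 2.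
have A0 : 0 < A by rewrite invr_gt0 exprn_gt0.
have B0 : 0 < B by rewrite invr_gt0 exprn_gt0.
have N0 : 0 < N1 + N2 by rewrite addr_gt0.
(* It suffices to bound each admissible [K], so the supremum need not be attained. *)
apply: ge_ereal_sup => _ [K /(CD_fin _ _ (lt0r_neq0 N0)) cd <-].
rewrite leNgt gt_max -!addeA -!EFinD; apply/negP => /andP[].
move=> /(curvature_lt_notCD A0) + /(curvature_lt_notCD B0).
set K1 := A^-1 * _; set K2 := B^-1 * _.
move=> /CD_fin - /(_ (lt0r_neq0 N1_gt0))/existsNP[f1 /negP].
rewrite -ltNge -subr_gt0 => d1_gt0.
move=> /CD_fin - /(_ (lt0r_neq0 N2_gt0))/existsNP[f2 /negP].
rewrite -ltNge -subr_gt0 => d2_gt0.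
have [A_ge0 B_ge0] := (ltW A0, ltW B0).
have [N1_ge0 N2_ge0] := (ltW N1_gt0, ltW N2_gt0).
have NV_ge0 : 0 <= (N1 + N2)^-1 by rewrite invr_ge0 ltW.
have [N1V_ge0 N2V_ge0] : 0 <= N1^-1 /\ 0 <= N2^-1 by rewrite !invr_ge0.
(* Since [A * alpha p ^+ 2 = 1], the two sides differ exactly by [A] times the degree term; likewise
   for [K2_le]. *)
have K1_le : A ^+ 2 * K1 + Q1 alpha beta x p 1 1 <= K * A.
  have -> : A ^+ 2 * K1 + Q1 alpha beta x p 1 1
      = K * A - A * (2 * N1^-1 * N2 * (N1 + N2)^-1 * deg x).
    by rewrite /K1 /A; field; rewrite !gt_eqF.
  rewrite lerBlDr lerDl mulr_ge0 // mulr_ge0 ?deg_ge0 //.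
  by rewrite mulr_ge0 // mulr_ge0 // mulr_ge0.
have K2_le : B ^+ 2 * K2 + Q2 alpha beta x p 1 1 <= K * B.
  have -> : B ^+ 2 * K2 + Q2 alpha beta x p 1 1
      = K * B - B * (2 * N1 * N2^-1 * (N1 + N2)^-1 * deg p).
    by rewrite /K2 /B; field; rewrite !gt_eqF.
  rewrite lerBlDr lerDl mulr_ge0 // mulr_ge0 ?deg_ge0 //.
  by rewrite mulr_ge0 // mulr_ge0 // mulr_ge0.
(* this choice makes [(a + b) ^ 2 / (N1 + N2) = a ^ 2 / N1 + b ^ 2 / N2] *)
have [c1 [c2 [cE c0]]] : exists c1 c2 : R,
    N2 * (A * (c1 * laplace f1 x)) = N1 * (B * (c2 * laplace f2 p))
    /\ (c1 != 0) || (c2 != 0).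
  (* If [laplace f1 x] vanishes, [f1] alone balances. Otherwise cross-multiplication does, with [c2]
     nonzero; [c1] may then be zero and either sign may occur. *)
  have [l1|l1] := eqVneq (laplace f1 x) 0.
    by exists 1, 0; rewrite l1 oner_neq0; split => //; ring.
  exists (N1 * (B * laplace f2 p)), (N2 * (A * laplace f1 x)).
  split; first by ring.
  apply/orP; right; apply: mulf_neq0; first by rewrite gt_eqF.
  by apply: mulf_neq0; rewrite ?l1 // gt_eqF.
(* The scalars are absorbed into the functions, so the estimate with [Q1] and [Q2] at [1 1]
   suffices. *)
pose g1 y := c1 * f1 y; pose g2 q := c2 * f2 q.
have := gamma2_sum_le alpha_gt0 beta_gt0 g1 g2 x p.
have := cd (fun z => g1 z.1 + g2 z.2).
rewrite laplace_sum gamma_sum !gammaZl !gammaZr !laplaceZ !gamma2Z -/A -/B.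
set a := A * _; set b := B * (c2 * laplace f2 p).
have -> : (N1 + N2)^-1 * (a + b) ^+ 2 = N1^-1 * a ^+ 2 + N2^-1 * b ^+ 2.
  have -> : b = N2 * a / N1 by rewrite cE mulrC mulKf ?gt_eqF.
  by field; rewrite !gt_eqF.
rewrite /a /b.
set w1 := gamma f1 f1 x in d1_gt0 *; set w2 := gamma f2 f2 p in d2_gt0 *.
have w1_ge0 : 0 <= w1 := gamma_ge0 f1 x.
have w2_ge0 : 0 <= w2 := gamma_ge0 f2 p.
set d1 := _ - _ in d1_gt0; set d2 := _ - _ in d2_gt0 => cdF leF.
have := le_trans cdF leF; rewrite leNgt => /negP; apply.
(* Both defects are strictly positive, so one nonzero scalar is enough for strictness. *)
have d_gt0 : 0 < (A * c1) ^+ 2 * d1 + (B * c2) ^+ 2 * d2.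
  have sqr_gt0 (t c : R) : 0 < t -> c != 0 -> 0 < (t * c) ^+ 2.
    by move=> t0 c0'; rewrite exprn_even_gt0 //= mulf_neq0 // gt_eqF.
  case/orP: c0 => c_neq0.
    apply: ltr_pwDl; first by apply: mulr_gt0 => //; exact: sqr_gt0.
    by apply: mulr_ge0; [exact: sqr_ge0|exact: ltW].
  apply: ltr_wpDl; first by apply: mulr_ge0; [exact: sqr_ge0|exact: ltW].
  by apply: mulr_gt0 => //; exact: sqr_gt0.
have e1 : 0 <= c1 ^+ 2 * w1 * (K * A - (A ^+ 2 * K1 + Q1 alpha beta x p 1 1)).
  by apply: mulr_ge0; rewrite ?subr_ge0 //; apply: mulr_ge0; rewrite ?sqr_ge0.
have e2 : 0 <= c2 ^+ 2 * w2 * (K * B - (B ^+ 2 * K2 + Q2 alpha beta x p 1 1)).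
  by apply: mulr_ge0; rewrite ?subr_ge0 //; apply: mulr_ge0; rewrite ?sqr_ge0.
(* The lower bound from [cdF] minus the upper bound from [leF] is the sum of the quantities in
   [d_gt0], [e1] and [e2], hence positive: a contradiction. *)
rewrite -subr_gt0; have := ltr_wpDr (addr_ge0 e1 e2) d_gt0.
congr (is_true (0 < _)); rewrite /d1 /d2; ring.
Qed.
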